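(* Let $m\ge n$ and let $A\in\mathbb{H}^{m\times n}$ be of full column rank. Let $I\subset\{1,\dots,m\}$ be a set of $r\ge n$ row indices such that $S=A[I,:]\in\mathbb{H}^{r\times n}$ is of full column rank, and let $$S=QR,\qquad Q^*Q=I_n,$$ be a reduced quaternion QR factorization ($Q\in\mathbb{H}^{r\times n}$, $R\in\mathbb{H}^{n\times n}$ upper triangular and invertible). Set $T=R^{-1}$. Assume that RectMaxVol returns $S$ with the coefficient bound $$\|A[i,:]S^{\dagger}\|_2\le\tau\qquad\text{for all } i\notin I.$$ Then $$\sigma_{\min}(AT)\ge 1\qquad\text{and}\qquad \sigma_{\max}(AT)\le\sqrt{n+(m-r)\tau^2}.$$ In particular, if $\tau\ge 1$, then $$\kappa_2(AT)\le\sqrt{n+(m-r)\tau^2}\le\sqrt{m}\,\tau.$$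
   Context: $\mathbb{H}$ is the skew field of real quaternions; $M^*$ is the conjugate transpose. $A[I,:]$ is the submatrix of rows in $I$ and $A[i,:]$ is the $i$th row. Full column rank means the columns are right-linearly independent over $\mathbb{H}$; in that case $S^\dagger=(S^*S)^{-1}S^*$ is the Moore–Penrose pseudoinverse. For a row vector $x\in\mathbb{H}^{1\times r}$, $\|x\|_2=(\sum_j|x_j|^2)^{1/2}$. Every $M\in\mathbb{H}^{m\times n}$ has a quaternion singular value decomposition $M=U\Sigma V^*$ with $U,V$ quaternion unitary and $\Sigma$ real nonnegative diagonal; for $m\ge n$, $\sigma_{\max}(M)$ and $\sigma_{\min}(M)$ denote the largest and smallest of its $n$ singular values, and $\kappa_2(M)=\sigma_{\max}(M)/\sigma_{\min}(M)$. RectMaxVol is a procedure that enlarges a selected row set $I$ until the row-coefficient norms $\|A[i,:]S^\dagger\|_2$, $i\notin I$, are at most a threshold $\tau$; only the stated coefficient bound on its output is used. *)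

(* Defs.v *)
From HB Require Import structures.
From mathcomp Require Import all_boot all_order all_algebra ring.
From mathcomp Require Import boolp classical_sets reals.

Set Implicit Arguments.
Unset Strict Implicit.
Unset Printing Implicit Defensive.

Import Order.TTheory GRing.Theory Num.Theory.
Local Open Scope ring_scope.

(* Built on MathComp matrices over a noncommutative nzRingType, with
   MathComp-Analysis' realType for the real numbers. *)

(* [Quat a b c d] is a + b i + c j + d k. *)
Record quat (R : Type) := Quat { qre : R; qi : R; qj : R; qk : R }.

Section QuaternionRing.

Definition tuple_of_quat (R : Type) (p : quat R) :=
  (qre p, qi p, qj p, qk p).
Definition quat_of_tuple (R : Type) (t : R * R * R * R) :=
  let: (a, b, c, d) := t in Quat a b c d.
Lemma tuple_of_quatK (R : Type) : cancel (@tuple_of_quat R) (@quat_of_tuple R).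
Proof. by case. Qed.

HB.instance Definition _ (R : eqType) :=
  Equality.copy (quat R) (can_type (@tuple_of_quatK R)).
HB.instance Definition _ (R : choiceType) :=
  Choice.copy (quat R) (can_type (@tuple_of_quatK R)).

Variable R : comNzRingType.
Implicit Types p q r : quat R.

Definition quat_add p q :=
  Quat (qre p + qre q) (qi p + qi q) (qj p + qj q) (qk p + qk q).
Definition quat_opp p := Quat (- qre p) (- qi p) (- qj p) (- qk p).
Definition quat_mul p q :=
  Quat (qre p * qre q - qi p * qi q - qj p * qj q - qk p * qk q)
       (qre p * qi q + qi p * qre q + qj p * qk q - qk p * qj q)
       (qre p * qj q - qi p * qk q + qj p * qre q + qk p * qi q)
       (qre p * qk q + qi p * qj q - qj p * qi q + qk p * qre q).

Fact quat_addA : associative quat_add.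
Proof. by move=> p q r; rewrite /quat_add /= !addrA. Qed.
Fact quat_addC : commutative quat_add.
Proof. by move=> p q; congr Quat; rewrite addrC. Qed.
Fact quat_add0l : left_id (Quat 0 0 0 0) quat_add.
Proof. by case=> *; rewrite /quat_add /= !add0r. Qed.
Fact quat_addNl : left_inverse (Quat 0 0 0 0) quat_opp quat_add.
Proof. by move=> p; rewrite /quat_add /= !addNr. Qed.

HB.instance Definition _ :=
  GRing.isZmodule.Build (quat R) quat_addA quat_addC quat_add0l quat_addNl.

Fact quat_mulA : associative quat_mul.
Proof. by move=> p q r; congr Quat => /=; ring. Qed.
Fact quat_mul1l : left_id (Quat 1 0 0 0) quat_mul.
Proof. by case=> *; congr Quat => /=; ring. Qed.
Fact quat_mul1r : right_id (Quat 1 0 0 0) quat_mul.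
Proof. by case=> *; congr Quat => /=; ring. Qed.
Fact quat_mulDl : left_distributive quat_mul quat_add.
Proof. by move=> p q r; congr Quat => /=; ring. Qed.
Fact quat_mulDr : right_distributive quat_mul quat_add.
Proof. by move=> p q r; congr Quat => /=; ring. Qed.
Fact quat_one_neq0 : Quat 1 0 0 0 != 0 :> quat R.
Proof. by apply/eqP => -[] /eqP; rewrite oner_eq0. Qed.

HB.instance Definition _ := GRing.Zmodule_isNzRing.Build (quat R)
  quat_mulA quat_mul1l quat_mul1r quat_mulDl quat_mulDr quat_one_neq0.

Definition quat_conj p := Quat (qre p) (- qi p) (- qj p) (- qk p).
Definition quat_real (a : R) : quat R := Quat a 0 0 0.

End QuaternionRing.

Definition quat_norm (R : realType) (q : quat R) : R :=
  Num.sqrt (qre q ^+ 2 + qi q ^+ 2 + qj q ^+ 2 + qk q ^+ 2).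

Definition rownorm2 (R : realType) (r : nat) (x : 'rV[quat R]_r) : R :=
  Num.sqrt (\sum_(j < r) quat_norm (x 0 j) ^+ 2).

Section QuaternionMatrices.
Variable R : realType.
Local Notation H := (quat R).

Definition adjmx m n (M : 'M[H]_(m, n)) : 'M[H]_(n, m) :=
  (map_mx (@quat_conj R) M)^T.

Definition unitarymxq n (U : 'M[H]_n) : Prop :=
  adjmx U *m U = 1%:M /\ U *m adjmx U = 1%:M.

Definition upper_trig n (M : 'M[H]_n) : Prop :=
  forall i j : 'I_n, (j < i)%N -> M i j = 0.

(* M *m x is the combination of the columns of M with the coefficients x
   multiplied on the right. *)
Definition full_col_rank m n (M : 'M[H]_(m, n)) : Prop :=
  forall x : 'cV[H]_n, M *m x = 0 -> x = 0.

Definition is_invmxq n (M N : 'M[H]_n) : Prop :=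
  M *m N = 1%:M /\ N *m M = 1%:M.

Definition invertible_mxq n (M : 'M[H]_n) : Prop := exists N, is_invmxq M N.

(* invmx needs commutative coefficients; a two-sided inverse is unique, and the
   value 0 is taken when there is none. *)
Definition invmxq n (M : 'M[H]_n) : 'M[H]_n :=
  xget 0 [set N | is_invmxq M N]%classic.

(* The Moore-Penrose pseudoinverse, for M of full column rank. *)
Definition pinvq m n (M : 'M[H]_(m, n)) : 'M[H]_(n, m) :=
  invmxq (adjmx M *m M) *m adjmx M.

(* The row submatrix A[I, :], with the rows in increasing order of index. *)
Definition rowset m n (A : 'M[H]_(m, n)) (I : {set 'I_m}) : 'M[H]_(#|I|, n) :=
  rowsub (fun k : 'I_#|I| => enum_val k) A.

Definition diag_rectmx m n (s : 'rV[R]_n) : 'M[H]_(m, n) :=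
  \matrix_(i < m, j < n) (if i == j :> nat then quat_real (s 0 j) else 0).

(* The n singular values are listed in s, in an arbitrary order; this is
   meaningful for n <= m. *)
Definition is_singular_values m n (M : 'M[H]_(m, n)) (s : 'rV[R]_n) : Prop :=
  (forall j, 0 <= s 0 j) /\
  exists (U : 'M[H]_m) (V : 'M[H]_n),
    [/\ unitarymxq U, unitarymxq V & M = U *m diag_rectmx m s *m adjmx V].

(* s is determined by M up to order, so that the largest and smallest entries
   do not depend on the choice; the value 0 would be taken in the absence of
   a decomposition. *)
Definition singular_values m n (M : 'M[H]_(m, n)) : 'rV[R]_n :=
  xget 0 [set s | is_singular_values M s]%classic.

Definition sigma_max m n (M : 'M[H]_(m, n)) : R :=
  \big[Num.max/0]_(j < n) singular_values M 0 j.

(* As the neutral value sigma_max M is an upper bound of the singular values,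
   this is their minimum for 0 < n. *)
Definition sigma_min m n (M : 'M[H]_(m, n)) : R :=
  \big[Num.min/sigma_max M]_(j < n) singular_values M 0 j.

Definition kappa2 m n (M : 'M[H]_(m, n)) : R := sigma_max M / sigma_min M.

End QuaternionMatrices.

(* Main.v *)
(* Write B = A T. Since S = Q R, the rows of B in I form Q, and S^+ = T Q^*, so
   that B[i,:] Q^* = A[i,:] S^+ has norm at most tau for i outside I; as Q^* Q is
   the identity, the same bound holds for B[i,:]. If B = U diag(s) V^*, then
   s_j^2 is the squared norm of the j-th column of B V. Its entries in I
   contribute those of Q V, that is 1, and each of the other m - r rows
   contributes between 0 and |B[i,:] V|^2 = |B[i,:]|^2 <= tau^2.
   The existence of the decomposition for full column rank is proved by
   deflation: B^* B, as a real self-adjoint operator, has an eigenvector with a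
   real eigenvalue; its normalization and that of its image are completed to
   quaternion unitary matrices by Householder reflections. *)
From HB Require Import structures.
Require Import Defs.
From mathcomp Require Import all_boot all_order all_algebra ring lra.
From mathcomp Require Import classical_sets reals complex.

Set Implicit Arguments.
Unset Strict Implicit.
Unset Printing Implicit Defensive.

Import Order.TTheory GRing.Theory Num.Theory.
Local Open Scope ring_scope.

(** * Eigenvectors of real self-adjoint operators *)

Lemma rV_dot_ge0 (R : realDomainType) n (x : 'rV[R]_n) :
  0 <= (x *m x^T) 0 0.
Proof. by rewrite mxE sumr_ge0 // => j _; rewrite mxE -expr2 sqr_ge0. Qed.

Lemma rV_dot_eq0 (R : realDomainType) n (x : 'rV[R]_n) :
  (x *m x^T) 0 0 = 0 -> x = 0.
Proof.
rewrite mxE => /eqP; rewrite psumr_eq0; last first.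
  by move=> j _; rewrite mxE -expr2 sqr_ge0.
move=> /allP x0; apply/rowP => j; rewrite [RHS]mxE; apply/eqP.
by have := x0 j (mem_index_enum j); rewrite /= mxE mulf_eq0 orbb.
Qed.

(** Over the algebraically closed field [R[i]] the matrix of [f] has an eigenvector z = x + i y,
    with eigenvalue a + b i. Symmetry forces b = 0, so that x and y both satisfy the real eigenvalue
    equation, and one of them is nonzero. *)
Lemma selfadjoint_eigenvector (R : rcfType) n (f : {linear 'rV[R]_n -> 'rV[R]_n}) :
  (0 < n)%N -> (forall x y, f x *m y^T = x *m (f y)^T) ->
  exists a (x : 'rV[R]_n), f x = a *: x /\ x != 0.
Proof.
move=> n0 symf; pose G := lin1_mx f; pose GC := map_mx (real_complex R) G.
have /closed_rootP[l] : size (char_poly GC) != 1.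
  by rewrite size_char_poly; case: n n0 {f symf G GC}.
rewrite -eigenvalue_root_char => /eigenvalueP[z zG z0].
pose x := map_mx (@complex.Re R) z; pose y := map_mx (@complex.Im R) z.
case: l zG => a b zG.
have xG : x *m G = a *: x - b *: y.
  apply/rowP => j; move/rowP/(_ j)/(congr1 (@complex.Re R)): zG.
  rewrite !mxE raddf_sum /= => zj.
  transitivity (complex.Re ((a +i* b)%C * z 0 j)); last by case: (z 0 j).
  rewrite -zj; apply: eq_bigr => k _; rewrite !mxE.
  by case: (z 0 k) => ? ? /=; ring.
have yG : y *m G = b *: x + a *: y.
  apply/rowP => j; move/rowP/(_ j)/(congr1 (@complex.Im R)): zG.
  rewrite !mxE raddf_sum /= => zj.
  transitivity (complex.Im ((a +i* b)%C * z 0 j)); last first.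
    by case: (z 0 j) => ? ? /=; ring.
  rewrite -zj; apply: eq_bigr => k _; rewrite !mxE.
  by case: (z 0 k) => ? ? /=; ring.
have xy0 : (x != 0) || (y != 0).
  apply: contraNT z0; rewrite negb_or !negbK => /andP[/eqP x0 /eqP y0].
  apply/eqP/rowP => j; move/rowP/(_ j): x0; move/rowP/(_ j): y0.
  by rewrite !mxE; case: (z 0 j) => ? ? /= -> ->.
pose dot (u v : 'rV[R]_n) := (u *m v^T) 0 0.
have dotC u v : dot u v = dot v u.
  by rewrite /dot -[in RHS](trmxK v) -trmx_mul [RHS]mxE.
have dotl c u d v w : dot (c *: u + d *: v) w = c * dot u w + d * dot v w.
  by rewrite /dot mulmxDl -!scalemxAl mxE [X in X + _]mxE [X in _ + X]mxE.
have b0 : b = 0.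
  (* Expanding both sides by [xG] and [yG] leaves b (|x|^2 + |y|^2) = 0. *)
  have : dot (x *m G) y = dot (y *m G) x.
    by rewrite dotC /dot !mul_rV_lin1 -symf.
  rewrite xG yG -scaleNr !dotl (dotC y x) => e.
  have bxy : b * (dot x x + dot y y) = 0 by nra.
  have x0 := rV_dot_ge0 x; have y0 := rV_dot_ge0 y; apply/eqP.
  apply: contraTT xy0 => b0; rewrite negb_or !negbK.
  move/eqP: bxy; rewrite mulf_eq0 (negPf b0) /= paddr_eq0 //.
  by case/andP=> /eqP/rV_dot_eq0 -> /eqP/rV_dot_eq0 ->; rewrite eqxx.
move: xG yG; rewrite b0 !scale0r subr0 add0r !mul_rV_lin1 => xG yG; exists a.
by case/orP: xy0 => ?; [exists x | exists y].
Qed.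

(** * Conjugation, norm and the embedding of the reals *)

Section QuaternionRing.
Variable R : comNzRingType.
Implicit Types p q : quat R.

Lemma quat_eq p q :
  qre p = qre q -> qi p = qi q -> qj p = qj q -> qk p = qk q -> p = q.
Proof. by case: p q => ? ? ? ? [? ? ? ?] /= -> -> -> ->. Qed.

Fact quat_real_is_zmod_morphism : zmod_morphism (@quat_real R).
Proof. by move=> a b; apply: quat_eq => /=; ring. Qed.
Fact quat_real_is_monoid_morphism : monoid_morphism (@quat_real R).
Proof. by split=> // a b; apply: quat_eq => /=; ring. Qed.
HB.instance Definition _ := GRing.isZmodMorphism.Build R (quat R)
  (@quat_real R) quat_real_is_zmod_morphism.
HB.instance Definition _ := GRing.isMonoidMorphism.Build R (quat R)
  (@quat_real R) quat_real_is_monoid_morphism.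

Fact quat_conj_is_zmod_morphism : zmod_morphism (@quat_conj R).
Proof. by move=> p q; apply: quat_eq => /=; ring. Qed.
HB.instance Definition _ := GRing.isZmodMorphism.Build (quat R) (quat R)
  (@quat_conj R) quat_conj_is_zmod_morphism.

Fact qre_is_zmod_morphism : zmod_morphism (@qre R).
Proof. by []. Qed.
HB.instance Definition _ := GRing.isZmodMorphism.Build (quat R) R
  (@qre R) qre_is_zmod_morphism.

Lemma quat_conjM p q : quat_conj (p * q) = quat_conj q * quat_conj p.
Proof. by apply: quat_eq => /=; ring. Qed.

Lemma quat_conjK : involutive (@quat_conj R).
Proof. by move=> p; apply: quat_eq => /=; ring. Qed.

Lemma quat_conj_real (a : R) : quat_conj (quat_real a) = quat_real a.
Proof. by apply: quat_eq => /=; ring. Qed.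

Lemma quat_realC (a : R) q : quat_real a * q = q * quat_real a.
Proof. by apply: quat_eq => /=; ring. Qed.

End QuaternionRing.

Lemma quat_norm_sqr (R : realType) (q : quat R) :
  quat_norm q ^+ 2 = qre q ^+ 2 + qi q ^+ 2 + qj q ^+ 2 + qk q ^+ 2.
Proof. by rewrite sqr_sqrtr // !addr_ge0 // sqr_ge0. Qed.

Lemma mul_conj_quat (R : realType) (q : quat R) :
  quat_conj q * q = quat_real (quat_norm q ^+ 2).
Proof. by rewrite quat_norm_sqr; apply: quat_eq => /=; ring. Qed.

Lemma mul_quat_conj (R : realType) (q : quat R) :
  q * quat_conj q = quat_real (quat_norm q ^+ 2).
Proof. by rewrite quat_norm_sqr; apply: quat_eq => /=; ring. Qed.

Lemma quat_norm_eq0 (R : realType) (q : quat R) : quat_norm q = 0 -> q = 0.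
Proof.
move=> q0; have := quat_norm_sqr q; rewrite q0 expr0n /= => e.
by apply: quat_eq => /=; nra.
Qed.

Lemma quat_real_inj (R : comNzRingType) : injective (@quat_real R).
Proof. by move=> a b []. Qed.

(** * Conjugate transpose, inverses and unitary matrices *)

Section QuaternionMatrices.
Variable R : realType.
Local Notation H := (quat R).

Lemma adjmxK m n : cancel (@adjmx R m n) (@adjmx R n m).
Proof. by move=> M; apply/matrixP => i j; rewrite !mxE quat_conjK. Qed.

Lemma adjmxM m n p (M : 'M[H]_(m, n)) (N : 'M[H]_(n, p)) :
  adjmx (M *m N) = adjmx N *m adjmx M.
Proof.
apply/matrixP => i j; rewrite !mxE raddf_sum; apply: eq_bigr => k _.
by rewrite !mxE; exact: quat_conjM.
Qed.

Lemma adjmxB m n (M N : 'M[H]_(m, n)) : adjmx (M - N) = adjmx M - adjmx N.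
Proof. by apply/matrixP => i j; rewrite !mxE raddfB. Qed.

Lemma adjmxN m n (M : 'M[H]_(m, n)) : adjmx (- M) = - adjmx M.
Proof. by apply/matrixP => i j; rewrite !mxE raddfN. Qed.

Lemma adjmxD m n (M N : 'M[H]_(m, n)) : adjmx (M + N) = adjmx M + adjmx N.
Proof. by apply/matrixP => i j; rewrite !mxE raddfD. Qed.

Lemma adjmx_scalar n q : adjmx (q%:M : 'M[H]_n) = (quat_conj q)%:M.
Proof. by apply/matrixP => i j; rewrite !mxE eq_sym raddfMn. Qed.

Lemma adjmx1 n : adjmx (1%:M : 'M[H]_n) = 1%:M.
Proof. by rewrite adjmx_scalar quat_conj_real. Qed.

Lemma adjmx0 m n : adjmx (0 : 'M[H]_(m, n)) = 0.
Proof. by apply/matrixP => i j; rewrite !mxE raddf0. Qed.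

Lemma adjmxZ m n a (M : 'M[H]_(m, n)) :
  adjmx (quat_real a *: M) = quat_real a *: adjmx M.
Proof.
by apply/matrixP => i j; rewrite !mxE quat_conjM quat_conj_real quat_realC.
Qed.

Lemma adjmx_row m n1 n2 (M : 'M[H]_(m, n1)) (N : 'M[H]_(m, n2)) :
  adjmx (row_mx M N) = col_mx (adjmx M) (adjmx N).
Proof. by rewrite /adjmx map_row_mx tr_row_mx. Qed.

Lemma adjmx_block m1 m2 n1 n2 (M1 : 'M[H]_(m1, n1)) M2 M3 (M4 : 'M[H]_(m2, n2)) :
  adjmx (block_mx M1 M2 M3 M4) =
    block_mx (adjmx M1) (adjmx M3) (adjmx M2) (adjmx M4).
Proof. by rewrite /adjmx map_block_mx tr_block_mx. Qed.

(** Real quaternions are central, hence pass through [M]; a general quaternion scalar does not. *)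
Lemma scalemx_realAr m n p a (M : 'M[H]_(m, n)) (N : 'M[H]_(n, p)) :
  M *m (quat_real a *: N) = quat_real a *: (M *m N).
Proof.
apply/matrixP => i j; rewrite !mxE mulr_sumr; apply: eq_bigr => k _.
by rewrite !mxE mulrA -quat_realC mulrA.
Qed.

Lemma mul_adjmx_diag m n (M : 'M[H]_(m, n)) j :
  (adjmx M *m M) j j = quat_real (\sum_i quat_norm (M i j) ^+ 2).
Proof.
by rewrite mxE raddf_sum; apply: eq_bigr => i _; rewrite !mxE mul_conj_quat.
Qed.

Lemma mul_mx_adjmx_diag m n (M : 'M[H]_(m, n)) i :
  (M *m adjmx M) i i = quat_real (\sum_j quat_norm (M i j) ^+ 2).
Proof.
by rewrite mxE raddf_sum; apply: eq_bigr => j _; rewrite !mxE mul_quat_conj.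
Qed.

(** This evaluates the choice made in [invmxq] once an explicit inverse is known. *)
Lemma is_invmxq_uniq n (M N : 'M[H]_n) : is_invmxq M N -> invmxq M = N.
Proof.
move=> [MN NM]; have [_ N'M] : is_invmxq M (invmxq M) by apply: xgetPex; exists N.
by rewrite -[LHS]mulmx1 -MN mulmxA N'M mul1mx.
Qed.

Lemma unitarymxqM n (U V : 'M[H]_n) :
  unitarymxq U -> unitarymxq V -> unitarymxq (U *m V).
Proof.
move=> [U1 U2] [V1 V2]; split; rewrite adjmxM.
  by rewrite mulmxA -(mulmxA (adjmx V)) U1 mulmx1.
by rewrite mulmxA -(mulmxA U) V2 mulmx1.
Qed.

Lemma unitarymxq_block m n (U : 'M[H]_m) (V : 'M[H]_n) :
  unitarymxq U -> unitarymxq V -> unitarymxq (block_mx U 0 0 V).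
Proof.
move=> [U1 U2] [V1 V2]; split; rewrite adjmx_block !adjmx0 mulmx_block.
  by rewrite U1 V1 !(mul0mx, mulmx0) !add0r addr0 -scalar_mx_block.
by rewrite U2 V2 !(mul0mx, mulmx0) !add0r addr0 -scalar_mx_block.
Qed.

Lemma unitarymxq1 n : unitarymxq (1%:M : 'M[H]_n).
Proof. by split; rewrite adjmx1 mulmx1. Qed.

End QuaternionMatrices.

(** * Quaternion columns as real vectors, and eigenvectors of self-adjoint quaternion matrices *)

Section RealCoordinates.
Variables (R : realType) (n : nat).
Local Notation H := (quat R).

(** The identification of H^n with R^(4n), one block for each of the units 1, i, j, k. *)
Definition real_coords (v : 'cV[H]_n) : 'rV[R]_(n + n + (n + n)) :=
  row_mx (row_mx (map_mx (@qre R) v)^T (map_mx (@qi R) v)^T)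
         (row_mx (map_mx (@qj R) v)^T (map_mx (@qk R) v)^T).

Definition of_real_coords (x : 'rV[R]_(n + n + (n + n))) : 'cV[H]_n :=
  \col_i Quat (lsubmx (lsubmx x) 0 i) (rsubmx (lsubmx x) 0 i)
              (lsubmx (rsubmx x) 0 i) (rsubmx (rsubmx x) 0 i).

Lemma real_coordsK : cancel real_coords of_real_coords.
Proof.
move=> v; apply/colP => i; rewrite /real_coords mxE !(row_mxKl, row_mxKr) !mxE.
by case: (v i 0).
Qed.

Lemma of_real_coordsK : cancel of_real_coords real_coords.
Proof.
move=> x; rewrite -[RHS]hsubmxK -[lsubmx x]hsubmxK -[rsubmx x]hsubmxK.
by congr (row_mx (row_mx _ _) (row_mx _ _)); apply/rowP => i; rewrite !mxE.
Qed.

Lemma real_coordsZD a v w :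
  real_coords (quat_real a *: v + w) = a *: real_coords v + real_coords w.
Proof.
rewrite /real_coords !scale_row_mx !add_row_mx.
by congr (row_mx (row_mx _ _) (row_mx _ _)); apply/rowP => i;
  rewrite !mxE /=; ring.
Qed.

Lemma of_real_coordsZD a x y :
  of_real_coords (a *: x + y) = quat_real a *: of_real_coords x + of_real_coords y.
Proof.
by rewrite -[LHS]real_coordsK -[RHS]real_coordsK real_coordsZD !of_real_coordsK.
Qed.

Lemma of_real_coords0 : of_real_coords 0 = 0.
Proof. by apply/colP => i; rewrite !mxE. Qed.

(** The real part of conj(p) q is the Euclidean inner product of p and q in R^4. Self-adjointness
    over the quaternions thus becomes symmetry over the reals. *)
Lemma real_coords_dot v w :
  (real_coords v *m (real_coords w)^T) 0 0 = qre ((adjmx v *m w) 0 0).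
Proof.
have mapE (f : H -> R) :
    ((map_mx f v)^T *m map_mx f w) 0 0 = \sum_i f (v i 0) * f (w i 0).
  by rewrite mxE; apply: eq_bigr => i _; rewrite !mxE.
have addE (M N : 'M[R]_1) : (M + N) 0 0 = M 0 0 + N 0 0 by rewrite mxE.
rewrite /real_coords !tr_row_mx !mul_row_col !trmxK !addE !mapE mxE.
rewrite (raddf_sum (@qre R)) -!big_split; apply: eq_bigr => i _ /=.
by rewrite !mxE /=; ring.
Qed.

(** In real coordinates, multiplication by [G] is a real linear operator, symmetric by
    [real_coords_dot]. Its real eigenvector is read back as a quaternion column. *)
Lemma adjmx_eigenvector (G : 'M[H]_n) : (0 < n)%N -> adjmx G = G ->
  exists a (v : 'cV[H]_n), G *m v = quat_real a *: v /\ v != 0.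
Proof.
move=> n0 GG; pose f x := real_coords (G *m of_real_coords x).
have f_linear : linear f.
  by move=> a x y; rewrite /f of_real_coordsZD mulmxDr scalemx_realAr real_coordsZD.
pose fL := GRing.isLinear.Build R _ _ _ f f_linear.
pose F : {linear _ -> _} := HB.pack f fL.
have [||a [x [fx x0]]] := @selfadjoint_eigenvector _ _ F.
- by rewrite !addn_gt0 n0.
- move=> x y; apply/matrixP => i j; rewrite !ord1.
  rewrite -[y in LHS]of_real_coordsK -[x in RHS]of_real_coordsK !real_coords_dot.
  by rewrite adjmxM GG mulmxA.
exists a, (of_real_coords x); split.
  rewrite -[LHS]real_coordsK -[real_coords _]/(F x) fx -[a *: x]addr0.
  by rewrite of_real_coordsZD of_real_coords0 addr0.
apply: contraNN x0 => /eqP v0; rewrite -[x]of_real_coordsK v0.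
by rewrite -of_real_coords0 of_real_coordsK.
Qed.

End RealCoordinates.

(** * Completion of a unit column to a unitary matrix *)

Section Completion.
Variable R : realType.
Local Notation H := (quat R).

(* The reflection along [u + e_1]: a real head [u 0 0] makes it swap [u] and
   [-e_1]. *)
Lemma householder n (u : 'cV[H]_(1 + n)) a : 0 <= a ->
    adjmx u *m u = 1%:M -> u 0 0 = quat_real a ->
  exists P : 'M[H]_(1 + n), unitarymxq P /\ lsubmx P = - u.
Proof.
move=> a0 uu u0; pose e : 'cV[H]_(1 + n) := col_mx 1%:M 0.
(* As |w|^2 = 2 (1 + a), the coefficient [c] equals 2 / |w|^2, that of a reflection; 0 <= a keeps 1
   + a away from 0. *)
pose w := u + e; pose c : R := (1 + a)^-1.
have ue : adjmx e *m u = (quat_real a)%:M.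
  rewrite /e /adjmx map_col_mx tr_col_mx -[u]vsubmxK mul_row_col.
  rewrite -/(adjmx _) -/(adjmx 0) adjmx1 adjmx0 mul0mx mul1mx addr0.
  by rewrite [LHS]mx11_scalar mxE -u0; congr (u _ _)%:M; apply: val_inj.
have eu : adjmx u *m e = (quat_real a)%:M.
  by rewrite -[LHS]adjmxK adjmxM adjmxK ue adjmx_scalar quat_conj_real.
have ee : adjmx e *m e = 1%:M.
  rewrite {1}/e /adjmx map_col_mx tr_col_mx mul_row_col.
  by rewrite -/(adjmx _) -/(adjmx 0) adjmx1 adjmx0 mul0mx mul1mx addr0.
have we : adjmx w *m e = quat_real (1 + a) *: 1%:M.
  by rewrite /w adjmxD mulmxDl eu ee scalemx1 rmorphD rmorph1 raddfD /= addrC.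
have ww : adjmx w *m w = quat_real (2 * (1 + a)) *: 1%:M.
  rewrite {2}/w mulmxDr we /w adjmxD mulmxDl uu ue !scalemx1 -!raddfD /=.
  by congr _%:M; apply: quat_eq => /=; ring.
have c1 : c * (1 + a) = 1 by rewrite mulVf // gt_eqF //; lra.
pose P := 1%:M - quat_real c *: (w *m adjmx w).
have adjP : adjmx P = P by rewrite /P adjmxB adjmxZ adjmxM adjmxK adjmx1.
have PP : P *m P = 1%:M.
  rewrite {1}/P mulmxBl mul1mx -scalemxAl /P mulmxBr mulmx1 scalemx_realAr.
  rewrite -mulmxA (mulmxA (adjmx w)) ww -scalemxAl mul1mx scalemx_realAr.
  rewrite !scalerBr !scalerA -!rmorphM /= -addrA -opprD.
  rewrite -scalerBl -scalerDl.
  (* Up to sign, this is the coefficient of w w^* in P^2. *)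
  suff -> : quat_real c + (quat_real c - quat_real (c * (c * (2 * (1 + a))))) = 0.
    by rewrite scale0r subr0.
  by rewrite -rmorphB -rmorphD mulrCA (mulrC _ (2 * _)) -mulrA (mulrC _ c) c1
    mulr1 -[c - _]opprB (_ : c * 2 - c = c) ?subrr ?rmorph0 //; ring.
exists P; split; first by rewrite /unitarymxq adjP PP.
have -> : lsubmx P = P *m e.
  by rewrite -[P in RHS]hsubmxK mul_row_col mulmx1 mulmx0 addr0.
(* The first column is P e = e - c (1 + a) w = e - w = - u. *)
rewrite /P mulmxBl mul1mx -scalemxAl -mulmxA we scalemx_realAr mulmx1.
by rewrite scalerA -rmorphM c1 scale1r /w opprD addrCA subrr addr0.
Qed.

(** Multiplying [v] on the right by a unit quaternion makes its head real and nonnegative, as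
    [householder] demands. The phase is restored afterwards in the first column. *)
Lemma unitary_completion n (v : 'cV[H]_(1 + n)) : adjmx v *m v = 1%:M ->
  exists V : 'M[H]_(1 + n), unitarymxq V /\ lsubmx V = v.
Proof.
move=> vv; set a := quat_norm (v 0 0).
have [w vw ww] : exists2 w, v 0 0 = - quat_real a * w & quat_norm w = 1.
  (* A vanishing head has no phase, and any unit quaternion serves. *)
  have [a0|a0] := eqVneq a 0.
    exists 1; first by rewrite a0 (quat_norm_eq0 a0); apply: quat_eq => /=; ring.
    by rewrite /quat_norm /= expr0n expr1n /= !addr0 sqrtr1.
  exists (- quat_real a^-1 * v 0 0).
    by rewrite !mulNr mulrN opprK mulrA -rmorphM divff // rmorph1 mul1r.
  apply/eqP; rewrite -(@eqrXn2 _ 2) ?sqrtr_ge0 // expr1n quat_norm_sqr.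
  rewrite /= (_ : _ + _ = a^-1 ^+ 2 * a ^+ 2); last first.
    by rewrite [a ^+ 2]quat_norm_sqr; ring.
  by rewrite exprVn mulVf // sqrf_eq0.
have ww1 : w * quat_conj w = 1 by rewrite mul_quat_conj ww expr1n rmorph1.
have ww2 : quat_conj w * w = 1 by rewrite mul_conj_quat ww expr1n rmorph1.
pose W : 'M[H]_1 := w%:M.
have unitW : unitarymxq W.
  by split; rewrite adjmx_scalar -scalar_mxM ?ww1 ?ww2.
have [] := @householder n (- (v *m adjmx W)) a.
- exact: sqrtr_ge0.
- rewrite adjmxN mulNmx mulmxN opprK adjmxM adjmxK -mulmxA (mulmxA _ v) vv.
  by rewrite mul1mx unitW.2.
- rewrite !mxE big_ord1 !mxE eqxx vw !mulr1n.
  by rewrite -mulrA ww1 mulr1 opprK.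
(* The first column of [P] is v W^*; the block factor multiplies it by [W] on the right and gives
   back [v]. *)
move=> P [unitP lP]; exists (P *m block_mx W 0 0 1%:M); split.
  by apply: unitarymxqM => //; apply: unitarymxq_block => //; apply: unitarymxq1.
rewrite -[P]hsubmxK mul_row_block row_mxKl lP opprK mulmx0 addr0 -mulmxA.
by rewrite unitW.1 mulmx1.
Qed.

End Completion.

(** * Existence of the singular value decomposition for full column rank *)

Section SingularValues.
Variable R : realType.
Local Notation H := (quat R).

Lemma column_sqr_norm n (v : 'cV[H]_n) : v != 0 ->
  exists2 p, 0 < p & adjmx v *m v = quat_real (p ^+ 2) *: 1%:M.
Proof.
move=> v0; set N := \sum_i quat_norm (v i 0) ^+ 2.
have N0 : 0 <= N by apply: sumr_ge0 => i _; rewrite sqr_ge0.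
exists (Num.sqrt N); last first.
  by rewrite sqr_sqrtr // scalemx1 [LHS]mx11_scalar mul_adjmx_diag.
rewrite sqrtr_gt0 lt0r N0 andbT; apply: contraNN v0.
rewrite psumr_eq0 => [/allP vi0|i _]; last by rewrite sqr_ge0.
apply/eqP/colP => i; rewrite [RHS]mxE; apply: quat_norm_eq0.
by apply/eqP; rewrite -sqrf_eq0; apply: vi0; apply: mem_index_enum.
Qed.

(** With q = |v| and p = |M v|, both positive by full rank, pairing the eigenvalue equation with v
    gives p^2 = a q^2. Then s = p / q, u = M v / p and w = v / q form a singular triple. *)
Lemma unit_column m n (M : 'M[H]_(m, n)) a (v : 'cV[H]_n) :
    full_col_rank M -> v != 0 -> adjmx M *m (M *m v) = quat_real a *: v ->
  exists (s : R) (u : 'cV[H]_m) (w : 'cV[H]_n),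
    [/\ 0 <= s, adjmx u *m u = 1%:M, adjmx w *m w = 1%:M,
        M *m w = quat_real s *: u & adjmx M *m u = quat_real s *: w].
Proof.
move=> fullM v0 Gv; have Mv0 : M *m v != 0 by apply: contraNN v0 => /eqP/fullM ->.
have [q q0 vv] := column_sqr_norm v0; have [p p0 MvMv] := column_sqr_norm Mv0.
have pq : p ^+ 2 = a * q ^+ 2.
  apply: (@quat_real_inj R); move: MvMv.
  rewrite adjmxM -mulmxA Gv scalemx_realAr vv scalerA -rmorphM /= !scalemx1.
  by move=> /(congr1 (fun N : 'M_1 => N 0 0)); rewrite !mxE eqxx !mulr1n.
have aE : a = p ^+ 2 / q ^+ 2 by rewrite pq mulfK // sqrf_eq0 gt_eqF.
have pp : p != 0 by rewrite gt_eqF.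
have qq : q != 0 by rewrite gt_eqF.
exists (p / q), (quat_real p^-1 *: (M *m v)), (quat_real q^-1 *: v); split.
- by rewrite divr_ge0 // ltW.
- rewrite adjmxZ -scalemxAl scalemx_realAr MvMv !scalerA -!rmorphM /=.
  by rewrite (_ : _ * _ = 1) ?rmorph1 ?scale1r //; field.
- rewrite adjmxZ -scalemxAl scalemx_realAr vv !scalerA -!rmorphM /=.
  by rewrite (_ : _ * _ = 1) ?rmorph1 ?scale1r //; field.
- rewrite scalemx_realAr scalerA -rmorphM /=.
  by congr (quat_real _ *: _); field; rewrite ?pp ?qq.
- rewrite scalemx_realAr Gv !scalerA -!rmorphM /= aE.
  by congr (quat_real _ *: _); field; rewrite ?pp ?qq.
Qed.

Lemma diag_rectmx_block m n (s : R) (t : 'rV[R]_n) :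
  diag_rectmx (1 + m) (row_mx s%:M t : 'rV[R]_(1 + n)) =
    block_mx (quat_real s)%:M 0 0 (diag_rectmx m t).
Proof.
apply/matrixP => i j; rewrite mxE.
case: (split_ordP i) => i' ->; case: (split_ordP j) => j' ->;
  rewrite ?row_mxEl ?row_mxEr ?(block_mxEul, block_mxEur, block_mxEdl, block_mxEdr).
- by rewrite !ord1 !mxE.
- by rewrite !ord1 mxE.
- by rewrite !ord1 !mxE.
- by rewrite mxE.
Qed.

(** Induction on the number of columns: in unitary bases starting with a singular pair [u], [w], the
    matrix splits into the 1 x 1 block [s] and a smaller block [C], again of full column rank, whose
    decomposition is bordered by 1. *)
Lemma singular_values_exist m n (M : 'M[H]_(m, n)) :
  (n <= m)%N -> full_col_rank M -> exists s, is_singular_values M s.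
Proof.
elim: n m M => [|n IHn] m M.
  move=> _ _; exists 0; split=> [[]//|]; exists 1%:M, 1%:M.
  by split; [exact: unitarymxq1 | exact: unitarymxq1 | apply/matrixP => ? []].
case: m M => [|m] // M le_nm fullM.
have [||a [v [Gv v0]]] := @adjmx_eigenvector R n.+1 (adjmx M *m M).
- by [].
- by rewrite adjmxM adjmxK.
rewrite -mulmxA in Gv.
have [s [u [w [s0 uu ww Mw Mu]]]] := unit_column fullM v0 Gv.
have [U [unitU lU]] := unitary_completion uu.
have [V [unitV lV]] := unitary_completion ww.
set U' := rsubmx U; set V' := rsubmx V.
have UE : U = row_mx u U' by rewrite -lU hsubmxK.
have VE : V = row_mx w V' by rewrite -lV hsubmxK.
pose C := adjmx U' *m M *m V'.
have [U'u wV'] : adjmx U' *m u = 0 /\ adjmx w *m V' = 0.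
  have := unitU.1; rewrite UE adjmx_row mul_col_row [1%:M]scalar_mx_block.
  case/eq_block_mx => _ _ -> _; split=> //.
  have := unitV.1; rewrite VE adjmx_row mul_col_row [1%:M]scalar_mx_block.
  by case/eq_block_mx.
have uM : adjmx u *m M = quat_real s *: adjmx w.
  by rewrite -adjmxZ -Mu adjmxM adjmxK.
(* The off-diagonal blocks vanish: u^* M V' = s w^* V' = 0 and U'^* M w = s U'^* u = 0. *)
have UMV : adjmx U *m M *m V = block_mx (quat_real s)%:M 0 0 C.
  rewrite UE VE adjmx_row mul_col_mx mul_col_row uM -!scalemxAl wV' ww scaler0.
  by rewrite scalemx1 -[_ *m w]mulmxA Mw scalemx_realAr U'u scaler0.
have ME : M = U *m block_mx (quat_real s)%:M 0 0 C *m adjmx V.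
  by rewrite -UMV !mulmxA unitU.2 mul1mx -mulmxA unitV.2 mulmx1.
have fullC : full_col_rank C.
  (* A kernel vector of [C], padded by a zero head and mapped by [V], is a kernel vector of [M]. *)
  move=> y Cy; have /fullM/(congr1 (mulmx (adjmx V))) : M *m (V *m col_mx 0 y) = 0.
    rewrite ME -!mulmxA (mulmxA (adjmx V)) unitV.1 mul1mx mul_block_col.
    by rewrite Cy !mulmx0 mul0mx !addr0 col_mx0 mulmx0.
  by rewrite mulmxA unitV.1 mul1mx mulmx0 -col_mx0 => /eq_col_mx[].
have [t [t0 [U2 [V2 [unitU2 unitV2 CE]]]]] := IHn m C le_nm fullC.
have st0 (j : 'I_(1 + n)) : 0 <= row_mx s%:M t 0 j.
  by case: (split_ordP j) => k ->; rewrite ?row_mxEl ?row_mxEr // ord1 mxE.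
exists (row_mx s%:M t : 'rV_(1 + n)); split; first exact: st0.
pose BU : 'M[H]_(1 + m) := block_mx 1%:M 0 0 U2.
pose BV : 'M[H]_(1 + n) := block_mx 1%:M 0 0 V2.
have unitBU : unitarymxq BU by apply: unitarymxq_block => //; apply: unitarymxq1.
have unitBV : unitarymxq BV by apply: unitarymxq_block => //; apply: unitarymxq1.
have BE : block_mx (quat_real s)%:M 0 0 C =
    BU *m diag_rectmx (1 + m) (row_mx s%:M t) *m adjmx BV.
  rewrite diag_rectmx_block /BU /BV adjmx_block adjmx1 !adjmx0 !mulmx_block.
  by rewrite !(mul0mx, mulmx0, mul1mx, mulmx1, addr0, add0r) CE.
exists (U *m BU), (V *m BV); split; [exact: unitarymxqM | exact: unitarymxqM |].
by rewrite {1}ME BE adjmxM !mulmxA.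
Qed.

(** Existence rules out the default value in [singular_values]. *)
Lemma singular_valuesP m n (M : 'M[H]_(m, n)) :
  (n <= m)%N -> full_col_rank M -> is_singular_values M (singular_values M).
Proof. by move=> le_nm fullM; apply: xgetPex; apply: singular_values_exist. Qed.

(** Since M V = U D with D the diagonal factor and U unitary, the columns of M V have the norms of
    those of D. *)
Lemma singular_values_sqr m n (M : 'M[H]_(m, n)) s : (n <= m)%N ->
    is_singular_values M s ->
  exists2 V, unitarymxq V &
    forall j, s 0 j ^+ 2 = \sum_i quat_norm ((M *m V) i j) ^+ 2.
Proof.
move=> le_nm [_ [U [V [unitU unitV ->]]]]; exists V => // j.
apply: (@quat_real_inj R).
rewrite -mul_adjmx_diag -[_ *m V]mulmxA unitV.1 mulmx1 adjmxM.
rewrite mulmxA -(mulmxA (adjmx _) (adjmx U)) unitU.1 mulmx1 mul_adjmx_diag.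
(* The only possibly nonzero entry of column j of the diagonal factor lies in row j, which exists
   because n <= m. *)
congr quat_real; rewrite (bigD1 (widen_ord le_nm j)) //= !mxE eqxx.
rewrite big1 => [|i]; last first.
  rewrite mxE -val_eqE /= => /negPf ->.
  by rewrite /quat_norm /= expr0n /= !addr0 sqrtr0 expr0n.
by rewrite addr0 quat_norm_sqr /= expr0n /= !addr0.
Qed.

End SingularValues.

(** * Singular values of a matrix containing an orthonormal block of rows *)

Section OrthonormalRows.
Variable R : realType.
Local Notation H := (quat R).

Lemma rownorm2_sqr n (x : 'rV[H]_n) :
  rownorm2 x ^+ 2 = \sum_j quat_norm (x 0 j) ^+ 2.
Proof. by rewrite sqr_sqrtr // sumr_ge0 // => j _; rewrite sqr_ge0. Qed.

(** The squared norm of x N is x N N^* x^*. The rectangular form covers both N = Q^* and a unitary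
    N. *)
Lemma rownorm2_coisometry n p (x : 'rV[H]_n) (N : 'M[H]_(n, p)) :
  N *m adjmx N = 1%:M -> rownorm2 (x *m N) = rownorm2 x.
Proof.
move=> NN; congr Num.sqrt; apply: (@quat_real_inj R).
by rewrite -!mul_mx_adjmx_diag adjmxM mulmxA -(mulmxA x) NN mulmx1.
Qed.

(** The Gram matrix of Q R is R^* R, with inverse T T^*, and T^* R^* = 1 cancels the rest. *)
Lemma pinvq_QR r n (Q : 'M[H]_(r, n)) (Rf T : 'M[H]_n) :
  adjmx Q *m Q = 1%:M -> is_invmxq Rf T -> pinvq (Q *m Rf) = T *m adjmx Q.
Proof.
move=> QQ [RT TR]; rewrite /pinvq (@is_invmxq_uniq _ _ _ (T *m adjmx T)).
  by rewrite adjmxM mulmxA -(mulmxA T) -adjmxM RT adjmx1 mulmx1.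
rewrite adjmxM -(mulmxA (adjmx Rf)) (mulmxA (adjmx Q)) QQ mul1mx; split.
  by rewrite mulmxA -(mulmxA (adjmx Rf)) RT mulmx1 -adjmxM TR adjmx1.
by rewrite mulmxA -(mulmxA T) -adjmxM RT adjmx1 mulmx1.
Qed.

Lemma rowset_mul m n p (A : 'M[H]_(m, n)) (B : 'M[H]_(n, p)) (I : {set 'I_m}) :
  rowset (A *m B) I = rowset A I *m B.
Proof.
by apply/matrixP => i j; rewrite !mxE; apply: eq_bigr => k _; rewrite mxE.
Qed.

Lemma singular_values_bounds m n (B : 'M[H]_(m, n)) (I : {set 'I_m}) tau s :
    (n <= m)%N -> adjmx (rowset B I) *m rowset B I = 1%:M ->
    (forall i, i \notin I -> rownorm2 (row i B) <= tau) ->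
    is_singular_values B s ->
  forall j, 1 <= s 0 j ^+ 2 <= 1 + (m%:R - #|I|%:R) * tau ^+ 2.
Proof.
move=> le_nm BI Btau /(singular_values_sqr le_nm)[V unitV sE] j.
have -> : s 0 j ^+ 2 = 1 + \sum_(i in ~: I) quat_norm ((B *m V) i j) ^+ 2.
  rewrite sE (bigID (mem I)) /=; congr (_ + _); last first.
    by apply: eq_bigl => i; rewrite inE.
  rewrite big_enum_val; apply: (@quat_real_inj R).
  have <- : (adjmx (rowset (B *m V) I) *m rowset (B *m V) I) j j = quat_real 1.
    rewrite rowset_mul adjmxM mulmxA -(mulmxA (adjmx V)) BI mulmx1 unitV.1.
    by rewrite mxE eqxx.
  rewrite mul_adjmx_diag; congr quat_real; apply: eq_bigr => k _.
  by rewrite [rowset _ _ k j]mxE.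
rewrite lerDl lerD2l sumr_ge0 /=; last by move=> i _; rewrite sqr_ge0.
have -> : m%:R - #|I|%:R = #|~: I|%:R :> R.
  by rewrite -{1}(card_ord m) -(cardsC I) natrD addrC addKr.
rewrite mulr_natl -sumr_const; apply: ler_sum => i; rewrite inE => iI.
(* One entry of row i of B V is at most the norm of that row, which [V] leaves unchanged. Squaring
   the bound uses 0 <= tau, itself a consequence of the bound on row i. *)
apply: (@le_trans _ _ (rownorm2 (row i B) ^+ 2)); last first.
  by rewrite lerXn2r ?Btau ?nnegrE ?sqrtr_ge0 // (le_trans _ (Btau i iI)) ?sqrtr_ge0.
rewrite -(rownorm2_coisometry _ unitV.2) rownorm2_sqr (bigD1 j) //= -row_mul.
by rewrite [row i _ 0 j]mxE lerDl sumr_ge0 // => k _; rewrite sqr_ge0.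
Qed.

End OrthonormalRows.

(** * Conditioning of the preconditioned matrix *)

Theorem proposition5 (R : realType) (m n : nat)
  (hn : (0 < n)%N) (hmn : (n <= m)%N)
  (A : 'M[quat R]_(m, n)) (hA : full_col_rank A)
  (I : {set 'I_m}) (hI : (n <= #|I|)%N)
  (hS : full_col_rank (rowset A I))
  (Q : 'M[quat R]_(#|I|, n)) (Rf : 'M[quat R]_n)
  (hQR : rowset A I = Q *m Rf)
  (hQ : adjmx Q *m Q = 1%:M)
  (hRf : upper_trig Rf) (hRfinv : invertible_mxq Rf)
  (T : 'M[quat R]_n) (hT : T = invmxq Rf)
  (tau : R)
  (hcoef : forall i : 'I_m, i \notin I ->
     rownorm2 (row i A *m pinvq (rowset A I)) <= tau) :
  [/\ 1 <= sigma_min (A *m T),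
      sigma_max (A *m T) <=
        Num.sqrt (n%:R + (m%:R - #|I|%:R) * tau ^+ 2)
    & 1 <= tau ->
        kappa2 (A *m T) <= Num.sqrt (n%:R + (m%:R - #|I|%:R) * tau ^+ 2) /\
        Num.sqrt (n%:R + (m%:R - #|I|%:R) * tau ^+ 2) <=
          Num.sqrt m%:R * tau].
Proof.
have TRf : is_invmxq Rf T by rewrite hT; apply: xgetPex.
have BI : rowset (A *m T) I = Q.
  by rewrite rowset_mul hQR -mulmxA TRf.1 mulmx1.
have fullB : full_col_rank (A *m T).
  move=> x; rewrite -mulmxA => /hA Tx.
  by rewrite -[x]mul1mx -TRf.1 -mulmxA Tx mulmx0.
have Btau i : i \notin I -> rownorm2 (row i (A *m T)) <= tau.
  (* Here S^+ = T Q^*, and right multiplication by Q^* preserves row norms. *)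
  move=> /hcoef; rewrite hQR (pinvq_QR hQ TRf) mulmxA row_mul.
  by rewrite rownorm2_coisometry // adjmxK.
have svB := singular_valuesP hmn fullB.
have s0 := svB.1.
have := singular_values_bounds hmn _ Btau svB; rewrite BI => /(_ hQ) sB.
have s_ge1 j : 1 <= singular_values (A *m T) 0 j.
  by have /andP[+ _] := sB j; rewrite -{1}[1](expr1n _ 2) ler_pXn2r // nnegrE.
set b := Num.sqrt _.
have s_le j : singular_values (A *m T) 0 j <= b.
  rewrite -(ger0_norm (s0 j)) -sqrtr_sqr ler_wsqrtr //.
  have /andP[_ /le_trans->//] := sB j.
  (* The sharper constant 1 is relaxed to n. *)
  by rewrite lerD2r ler1n.
have max_ge1 : 1 <= sigma_max (A *m T).
  exact: le_trans (s_ge1 (Ordinal hn)) (le_bigmax _ _ _).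
have max_le : sigma_max (A *m T) <= b.
  (* The neutral value 0 of the maximum has to obey the bound too; for the minimum below, the
     neutral value is [sigma_max], handled by [max_ge1]. *)
  by apply/bigmax_leP; split=> [|j _]; [exact: sqrtr_ge0 | exact: s_le].
have min_ge1 : 1 <= sigma_min (A *m T).
  by apply/bigmin_geP; split=> // j _; exact: s_ge1.
split=> // tau1; split.
  (* Dividing by [sigma_min], which is at least 1, does not increase [sigma_max]. *)
  apply: le_trans max_le; rewrite /kappa2 ler_pdivrMr ?(lt_le_trans ltr01) //.
  by rewrite ler_peMr // (le_trans ler01).
rewrite -(ger0_norm (le_trans ler01 tau1)) -sqrtr_sqr -sqrtrM ?ler0n //.
(* Under the root, the claim reduces to n <= r tau^2 with r = #|I|, which follows from n <= r and 1
   <= tau. *)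
rewrite /b ler_wsqrtr // mulrBl addrCA gerDl subr_le0.
apply: (@le_trans _ _ #|I|%:R); first by rewrite ler_nat.
by rewrite ler_peMr ?ler0n // -[1](expr1n _ 2) ler_pXn2r // nnegrE
  ?(le_trans _ tau1).
Qed.
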